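(* Suppose that $f:\mathbb R\setminus\mathbb Z\to\mathbb R$ is $1$-periodic, continuous on $(0,1)$, and satisfies $f(0+)=-\infty$, $f(1-)=+\infty$. Then $\sigma(H(x))=\mathbb R$ for all $\alpha\in\mathbb R$ and all $x\in\mathbb R\setminus(\mathbb Z+\alpha\mathbb Z)$.
   Context: For $\alpha\in\mathbb R$ and $x\in\mathbb R\setminus(\mathbb Z+\alpha\mathbb Z)$, $H(x)$ is the self-adjoint operator on $\ell^2(\mathbb Z)$ given by $(H(x)\psi)(n)=\psi(n+1)+\psi(n-1)+f(x+n\alpha)\psi(n)$ (possibly unbounded; it is essentially self-adjoint on finitely supported vectors). $\sigma(H(x))$ denotes its spectrum.
   Formalization: The claim is proved for irrational α only, not for all α ∈ ℝ: for rational α = p/q the potential f(x+nα) takes at most q finite values, so H(x) is bounded and σ(H(x)) is compact, hence never ℝ. *)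

(* Defs.v *)
From HB Require Import structures.
From mathcomp Require Import all_boot all_order all_algebra.
From mathcomp Require Import complex.
From mathcomp Require Import all_classical all_reals all_analysis.

Set Implicit Arguments.
Unset Strict Implicit.
Unset Printing Implicit Defensive.

Import Order.TTheory GRing.Theory Num.Theory.
Import numFieldNormedType.Exports.

Local Open Scope classical_set_scope.
Local Open Scope ring_scope.

(* Complex-valued l^2(Z). *)

Definition l2_sqnorm (R : realType) (psi : int -> R[i]) : \bar R :=
  (\esum_(n in [set: int]) (Normc.normc (psi n) ^+ 2)%:E)%E.

Definition l2 (R : realType) : set (int -> R[i]) :=
  [set psi | (l2_sqnorm psi < +oo)%E].
Arguments l2 : clear implicits.

(* [fine] sends +oo to 0, so this is the norm only on [l2 R]. *)
Definition l2_norm (R : realType) (psi : int -> R[i]) : R :=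
  Num.sqrt (fine (l2_sqnorm psi)).

(* A possibly unbounded operator on l^2(Z): the values of [op_fun] outside
   [op_dom] are irrelevant. *)
Record l2_operator (R : realType) := L2Operator {
  op_dom : set (int -> R[i]);
  op_fun : (int -> R[i]) -> (int -> R[i])
}.

Definition op_shift (R : realType) (A : l2_operator R) (z : R[i])
    (psi : int -> R[i]) : int -> R[i] :=
  fun n => op_fun A psi n - z * psi n.

(* z is in the resolvent set iff A - z : op_dom A -> l^2(Z) is a bijection
   whose inverse is bounded. *)
Definition resolvent_set (R : realType) (A : l2_operator R) : set R[i] :=
  [set z | set_bij (op_dom A) (l2 R) (op_shift A z) /\
           exists M : R, forall psi, op_dom A psi ->
             l2_norm psi <= M * l2_norm (op_shift A z psi)].

Definition spectrum (R : realType) (A : l2_operator R) : set R[i] :=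
  ~` resolvent_set A.

Definition schrodinger_fun (R : realType) (f : R -> R) (alpha x : R)
    (psi : int -> R[i]) : int -> R[i] :=
  fun n => psi (n + 1) + psi (n - 1)
           + real_complex R (f (x + n%:~R * alpha)) * psi n.

(* H(x) on its maximal domain. The potential is real and the shifts are
   bounded, so this domain is {psi in l^2 | f(x + n alpha) psi(n) in l^2};
   finitely supported vectors are a core (cut off psi), and the operator is
   the self-adjoint closure of its restriction to them. *)
Definition schrodinger (R : realType) (f : R -> R) (alpha x : R) :
    l2_operator R :=
  L2Operator [set psi | l2 R psi /\ l2 R (schrodinger_fun f alpha x psi)]
             (schrodinger_fun f alpha x).

(* Main.v *)
Require Import Defs.
From HB Require Import structures.
From mathcomp Require Import all_boot all_order all_algebra.
From mathcomp Require Import complex finmap.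
From mathcomp Require Import all_classical all_reals all_analysis.
From mathcomp Require Import zify ring lra.

Set Implicit Arguments.
Unset Strict Implicit.
Unset Printing Implicit Defensive.

Import Order.TTheory GRing.Theory Num.Theory.
Import numFieldNormedType.Exports.

Local Open Scope classical_set_scope.
Local Open Scope ring_scope.

(** Non-real energies. Pairing [(H - z) psi] with [psi] and taking imaginary
    parts, the real potential drops out and the hopping terms telescope to
    Wronskians at the ends, so [|Im z| ||psi|| <= ||(H - z) psi||]. The Dirichlet
    problems on [-N, N] are therefore solvable with uniform bounds, and limits
    of their solutions along an ultrafilter invert [H - z].

    Real energies. Put [g = f - E]. The pair [(c, s) = (g, 1) / (1 + |g|)] on
    (0, 1) tends to (-1, 0) at 0+ and to (1, 0) at 1-, so it extends to a
    uniformly continuous pair on the line changing sign under [t |-> t + 1].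
    Substituting [psi = s phi] turns [H - E] into the regular operator
    [(T phi) n = s_(n+1) phi_(n+1) + s_(n-1) phi_(n-1) + c_n phi_n], and if [E]
    were in the resolvent set then [||phi||^2 <= C ||T phi||^2] would hold on
    every finite window of every translate. Now close the chain into a ring of
    [q] sites with slope [p / q] close to [alpha], [p] even and [q] odd: under
    [y |-> y + 1] each column of the ring matrix changes sign, so its
    determinant is odd and vanishes somewhere, giving a [q]-periodic solution
    of [T phi = 0]. Cutting it off to windows of length [L] leaves only four
    boundary terms, up to a small error from replacing [p / q] by [alpha];
    averaging over the ring gives [L <= 16 C], absurd for [L] large. *)

(** * Square-summable sequences through finite windows *)

Section Windows.
Variable R : realType.
Implicit Types (F : int -> R) (psi chi : int -> R[i]).

Definition window_sum F (m : int) (L : nat) : R := \sum_(i < L) F (m + i%:Z).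

Lemma ler_sum_subseq (T : eqType) (G : T -> R) (s r : seq T) :
  (forall x, 0 <= G x) -> uniq s -> uniq r -> {subset s <= r} ->
  \sum_(x <- s) G x <= \sum_(x <- r) G x.
Proof.
move=> G0 us ur sr; rewrite [leRHS](bigID (mem s))/=.
suff -> : \sum_(x <- r | x \in s) G x = \sum_(x <- s) G x.
  by rewrite lerDl sumr_ge0.
rewrite -big_filter; apply: perm_big; apply: uniq_perm => //.
  exact: filter_uniq.
by move=> x; rewrite mem_filter; case: (boolP (x \in s)) => // /sr ->.
Qed.

Lemma window_sumE F m L :
  window_sum F m L = \sum_(n <- [seq m + i%:Z | i <- iota 0 L]) F n.
Proof.
rewrite big_map /window_sum -(big_mkord xpredT (fun i => F (m + i%:Z))).
by rewrite /index_iota subn0.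
Qed.

Lemma window_uniq (m : int) L : uniq [seq m + i%:Z | i <- iota 0 L].
Proof. by rewrite map_inj_uniq ?iota_uniq // => i j /addrI []. Qed.

Lemma window_le_esum F m L : (forall n, 0 <= F n) ->
  ((window_sum F m L)%:E <= \esum_(n in [set: int]) (F n)%:E)%E.
Proof.
move=> F0; apply: esum_ge.
exists [set` [fset x in [seq (m + i%:Z)%R | i <- iota 0 L]]%fset] => //.
rewrite fsbig_finite//= set_fsetK window_sumE sumEFin lee_fin.
apply: ler_sum_subseq => //; [exact: window_uniq|exact: fset_uniq|].
by move=> k; rewrite !inE.
Qed.

(** Any finite set of integers lies in some [-N, N], so symmetric windows already control the
    unordered sum. *)
Lemma esum_le_window F (B : R) : (forall n, 0 <= F n) ->
  (forall N : nat, window_sum F (- N%:Z) (2 * N).+1 <= B) ->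
  (\esum_(n in [set: int]) (F n)%:E <= B%:E)%E.
Proof.
move=> F0 FB; apply: ge_ereal_sup => _ [A [finA _] <-].
rewrite fsbig_finite//= sumEFin lee_fin.
pose N := \max_(k <- fset_set A) `|k|%N.
apply: le_trans (FB N); rewrite window_sumE.
apply: ler_sum_subseq => //; [exact: fset_uniq|exact: window_uniq|].
move=> k kA; have kN : (`|k| <= N)%N.
  by rewrite /N (big_rem k kA) leq_maxl.
apply/mapP; exists (absz (k + N%:Z)%R); last by lia.
by rewrite mem_iota; lia.
Qed.

(** The squared modulus as a polynomial in real and imaginary parts, a form that [ring], [lra] and
    [nra] can handle. *)
Definition sqc (z : R[i]) : R := complex.Re z ^+ 2 + complex.Im z ^+ 2.

Lemma sqc_ge0 z : 0 <= sqc z.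
Proof. by rewrite addr_ge0 ?sqr_ge0. Qed.

Lemma normc_sqr z : Normc.normc z ^+ 2 = sqc z.
Proof. by case: z => a b; rewrite sqr_sqrtr // addr_ge0 ?sqr_ge0. Qed.

Lemma sqc_eq0 z : sqc z = 0 -> z = 0.
Proof.
case: z => a b /eqP; rewrite /sqc/= paddr_eq0 ?sqr_ge0// !sqrf_eq0.
by move=> /andP[/eqP-> /eqP->].
Qed.

Lemma sqcD z w : sqc (z + w) <= 2 * (sqc z + sqc w).
Proof.
case: z w => [a b] [c d]; rewrite /sqc/= -subr_ge0.
have -> : 2 * (a ^+ 2 + b ^+ 2 + (c ^+ 2 + d ^+ 2)) -
  ((a + c) ^+ 2 + (b + d) ^+ 2) = (a - c) ^+ 2 + (b - d) ^+ 2 by ring.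
by rewrite addr_ge0 ?sqr_ge0.
Qed.

Lemma sqcM z w : sqc (z * w) = sqc z * sqc w.
Proof. by case: z w => [a b] [c d]; rewrite /sqc/=; ring. Qed.

Lemma l2_sqnormE psi :
  l2_sqnorm psi = (\esum_(n in [set: int]) (sqc (psi n))%:E)%E.
Proof. by apply: eq_esum => n _; rewrite normc_sqr. Qed.

Lemma l2_sqnorm_ge0 psi : (0 <= l2_sqnorm psi)%E.
Proof. by apply: esum_ge0 => n _; rewrite lee_fin sqr_ge0. Qed.

Lemma window_le_l2 psi m L : l2 R psi ->
  window_sum (sqc \o psi) m L <= fine (l2_sqnorm psi).
Proof.
move=> fin; have := @window_le_esum (sqc \o psi) m L (fun=> sqc_ge0 _).
rewrite -l2_sqnormE -lee_fin fineK // ge0_fin_numE//.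
exact: l2_sqnorm_ge0.
Qed.

Lemma l2_window psi (B : R) :
  (forall N : nat, window_sum (sqc \o psi) (- N%:Z) (2 * N).+1 <= B) ->
  l2 R psi /\ fine (l2_sqnorm psi) <= B.
Proof.
move=> psiB; have := esum_le_window (fun=> sqc_ge0 _) psiB.
rewrite -l2_sqnormE => le_B; have fin : l2 R psi.
  exact: le_lt_trans le_B (ltry _).
by split => //; rewrite -lee_fin fineK // ge0_fin_numE// l2_sqnorm_ge0.
Qed.

Lemma window_sumD F G m L :
  window_sum (fun n => F n + G n) m L = window_sum F m L + window_sum G m L.
Proof. exact: big_split. Qed.

Lemma window_sumZ a F m L :
  window_sum (fun n => a * F n) m L = a * window_sum F m L.
Proof. by rewrite /window_sum mulr_sumr. Qed.

Lemma le_window_sum F G m L : (forall n, F n <= G n) ->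
  window_sum F m L <= window_sum G m L.
Proof. by move=> FG; apply: ler_sum. Qed.

Lemma l2D psi chi : l2 R psi -> l2 R chi -> l2 R (fun n => psi n + chi n).
Proof.
move=> lpsi lchi.
apply: (proj1 (l2_window (B := 2 * (fine (l2_sqnorm psi) + fine (l2_sqnorm chi))) _)).
move=> N; apply: le_trans (le_window_sum _ _ (fun n => sqcD (psi n) (chi n))) _.
rewrite window_sumZ window_sumD ler_wpM2l// lerD//; exact: window_le_l2.
Qed.

Lemma l2Z a psi : l2 R psi -> l2 R (fun n => a * psi n).
Proof.
move=> lpsi.
apply: (proj1 (l2_window (B := sqc a * fine (l2_sqnorm psi)) _)).
move=> N; apply: le_trans (le_window_sum (G := fun n => sqc a * sqc (psi n)) _ _ _) _.
  by move=> n /=; rewrite sqcM.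
by rewrite window_sumZ ler_wpM2l ?sqc_ge0//; exact: window_le_l2.
Qed.

Lemma l2_normP psi chi (K : R) : 0 <= K -> l2 R psi -> l2 R chi ->
  fine (l2_sqnorm psi) <= K ^+ 2 * fine (l2_sqnorm chi) ->
  l2_norm psi <= K * l2_norm chi.
Proof.
move=> K0 lpsi lchi le; rewrite /l2_norm.
rewrite -[K in leRHS]ger0_norm// -sqrtr_sqr -sqrtrM ?sqr_ge0//.
by rewrite ler_sqrt // mulr_ge0 ?sqr_ge0 ?fine_ge0 ?l2_sqnorm_ge0.
Qed.

Lemma l2_norm_sqr psi : l2_norm psi ^+ 2 = fine (l2_sqnorm psi).
Proof. by rewrite sqr_sqrtr// fine_ge0 ?l2_sqnorm_ge0. Qed.

End Windows.

(** * Non-real energies *)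

Section NonReal.
Variable R : realType.
Implicit Types (u chi : nat -> R[i]) (psi : int -> R[i]).

(** The imaginary part of conj(z) w: for consecutive values of a sequence, up to a constant factor,
    the Wronskian of the sequence and its conjugate. *)
Definition wronskian (z w : R[i]) : R :=
  complex.Re z * complex.Im w - complex.Im z * complex.Re w.

Lemma wronskian_le (z w : R[i]) : 2 * `|wronskian z w| <= sqc z + sqc w.
Proof.
case: z w => [a b] [c d]; rewrite /wronskian /sqc/=.
rewrite -[2]ger0_norm// -normrM ler_norml.
have := addr_ge0 (sqr_ge0 (a - d)) (sqr_ge0 (b + c)).
have := addr_ge0 (sqr_ge0 (a + d)) (sqr_ge0 (b - c)).
by move=> h1 h2; apply/andP; split; lra.
Qed.

(** With y = Im z, expand |chi_k + i y u_(k+1)|^2 >= 0 and sum over k. In the cross term 2 y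
    Im(conj(u_(k+1)) chi_k) the real potential drops out, the energy contributes -2 y^2 |u_(k+1)|^2,
    and the hopping contributes a difference of neighbouring Wronskians, which telescopes. *)
Lemma energy_bound (v : nat -> R) (z : R[i]) (L : nat) u chi :
  (forall i, (i < L)%N ->
    u i.+2 + u i + real_complex R (v i) * u i.+1 - z * u i.+1 = chi i) ->
  complex.Im z ^+ 2 * \sum_(i < L) sqc (u i.+1) <=
    2 * `|complex.Im z| * (`|wronskian (u 0%N) (u 1%N)| + `|wronskian (u L) (u L.+1)|)
    + \sum_(i < L) sqc (chi i).
Proof.
set y := complex.Im z => eq_u.
(* The signed boundary term telescopes, so this form is open to induction on [L]. *)
suff : y ^+ 2 * \sum_(i < L) sqc (u i.+1) <=
    2 * y * (wronskian (u L) (u L.+1) - wronskian (u 0%N) (u 1%N))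
    + \sum_(i < L) sqc (chi i).
  move=> /le_trans; apply; rewrite lerD2r -!mulrA ler_wpM2l//.
  apply: le_trans (ler_norm _) _; rewrite normrM ler_wpM2l//.
  by rewrite [leRHS]addrC ler_normB.
elim: L eq_u => [|L IH] eq_u; first by rewrite !big_ord0 subrr !mulr0 addr0.
have {}IH := IH (fun i iL => eq_u i (ltnW iL)).
rewrite !big_ord_recr/= -(eq_u L (ltnSn L)); move: IH.
set S := (\sum_(i < L) sqc (u i.+1)); set T := (\sum_(i < L) _).
rewrite /wronskian /sqc/=.
move: (u L) (u L.+1) (u L.+2) (u 0%N) (u 1%N) (v L)
  => [a0 b0] [a1 b1] [a2 b2] [p0 q0] [p1 q1] w.
rewrite {}/y; case: z {eq_u} => [x y] /=.
rewrite !mul0r !addr0 !subr0 => IH.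
set X := a2 + a0 + w * a1 - (x * a1 - y * b1).
set Y := b2 + b0 + w * b1 - (x * b1 + y * a1).
(* This is |chi + i y u|^2 at the new site, where chi = X + i Y. *)
have := addr_ge0 (sqr_ge0 (X - y * b1)) (sqr_ge0 (Y + y * a1)).
move: IH; rewrite /X /Y => IH sq; nra.
Qed.

(** Shooting for the Dirichlet problem: the state is a pair of consecutive values, and the initial
    slope [t] is to be adjusted. *)
Fixpoint shoot (c : nat -> R[i]) chi (t : R[i]) (n : nat) : R[i] * R[i] :=
  if n is k.+1 then
    let p := shoot c chi t k in (p.2, chi k - p.1 - c k * p.2)
  else (0, t).

(** The recursion is linear, so the condition at the far end becomes one affine equation in [t]. *)
Lemma shoot_affine c chi t n :
  shoot c chi t n =
    ((shoot c chi 0 n).1 + t * (shoot c (fun=> 0) 1 n).1,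
     (shoot c chi 0 n).2 + t * (shoot c (fun=> 0) 1 n).2).
Proof.
elim: n => [|n /= ->] /=; first by congr pair; ring.
by congr pair; ring.
Qed.

Lemma dirichlet_solution (v : nat -> R) (z : R[i]) (L : nat) chi :
  complex.Im z != 0 ->
  exists u, [/\ u 0%N = 0, u L.+1 = 0 & forall i,
    u i.+2 + u i + real_complex R (v i) * u i.+1 - z * u i.+1 = chi i].
Proof.
move=> z0; pose c i := real_complex R (v i) - z.
have rec chi' t i : (shoot c chi' t i.+2).1 + (shoot c chi' t i).1 +
    real_complex R (v i) * (shoot c chi' t i.+1).1 - z * (shoot c chi' t i.+1).1 = chi' i.
  by rewrite /= /c; ring.
pose b := (shoot c (fun=> 0) 1 L.+1).1.
(* Otherwise the homogeneous solution started at (0, 1) vanishes at both ends, both Wronskians are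
   zero, and [energy_bound] kills it although its value at index 1 is 1. For [L = 0], [b] is that
   value itself. *)
have b0 : b != 0.
  apply/eqP => b0.
  have := energy_bound (L := L) (fun i _ => rec (fun=> 0) 1 i).
  rewrite -/b b0 /wronskian/= !mul0r !mulr0 !subrr normr0 addr0 mulr0 add0r.
  rewrite [leRHS]big1 => [|i _]; last by rewrite /sqc/= expr0n addr0.
  move: b0; rewrite /b; case: L {b} => [/= /eqP|L _]; first by rewrite oner_eq0.
  rewrite leNgt => /negP; apply; rewrite pmulr_rgt0; last first.
    by rewrite lt0r sqrf_eq0 z0 sqr_ge0.
  rewrite big_ord_recl/= {1}/sqc/= expr1n expr0n addr0.
  by rewrite ltr_pwDl// sumr_ge0// => i _; exact: sqc_ge0.
pose t := - (shoot c chi 0 L.+1).1 / b.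
exists (fun i => (shoot c chi t i).1); split => //.
by rewrite shoot_affine/= -/b /t mulfVK// addrN.
Qed.

End NonReal.

(** * The a priori bound on the whole line *)

Section JacobiBound.
Variable R : realType.
Implicit Types (psi chi : int -> R[i]).

Lemma window_sum_sub (F : int -> R) (m : int) L (m' : int) L' : (forall n, 0 <= F n) ->
  m' <= m -> m + L%:Z <= m' + L'%:Z ->
  window_sum F m L <= window_sum F m' L'.
Proof.
move=> F0 mm' LL'; rewrite !window_sumE; apply: ler_sum_subseq => //.
- exact: window_uniq.
- exact: window_uniq.
move=> k /mapP[j]; rewrite mem_iota => jL ->.
apply/mapP; exists (absz (m + j%:Z - m')%R); last by lia.
by rewrite mem_iota; lia.
Qed.

(** Otherwise enough terms above [e] beyond [N] would exceed [B]. This supplies far sites with small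
    boundary Wronskians. *)
Lemma small_tail (F : nat -> R) (B : R) : (forall n, 0 <= F n) ->
  (forall L, \sum_(i < L) F i <= B) ->
  forall e N, 0 < e -> exists2 n, (N <= n)%N & F n <= e.
Proof.
move=> F0 FB e N e0; apply: contrapT => Ne.
have eF n : (N <= n)%N -> e < F n.
  by move=> Nn; rewrite ltNge; apply/negP => Fe; apply: Ne; exists n.
have B0 : 0 <= B by have := FB 0%N; rewrite big_ord0.
have := archi_boundP (divr_ge0 B0 (ltW e0)).
set K := Num.bound _; rewrite ltr_pdivrMr// ltNge => /negP; apply.
apply: le_trans (FB (N + K)%N); rewrite big_split_ord/=.
apply: ler_wpDl; first exact: sumr_ge0.
rewrite -[K in K%:R]card_ord mulr_natl -sumr_const.
by apply: ler_sum => i _; rewrite ltW// eF// leq_addr.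
Qed.

(** H - z for an arbitrary real potential; for the potential along the orbit it is convertible to
    [op_shift] of [schrodinger]. *)
Definition jacobi (v : int -> R) (z : R[i]) psi (n : int) : R[i] :=
  psi (n + 1) + psi (n - 1) + real_complex R (v n) * psi n - z * psi n.

Lemma jacobi_window v z psi m i :
  psi (m + i.+2%:Z) + psi (m + i%:Z) + real_complex R (v (m + 1 + i%:Z)) * psi (m + i.+1%:Z)
    - z * psi (m + i.+1%:Z) = jacobi v z psi (m + 1 + i%:Z).
Proof.
rewrite /jacobi; have -> : m + i.+2%:Z = m + 1 + i%:Z + 1 by lia.
have -> : m + i.+1%:Z = m + 1 + i%:Z by lia.
by congr (_ + psi _ + _ - _); lia.
Qed.

Lemma window_sumS (F : int -> R) m L :
  \sum_(i < L) F (m + i.+1%:Z) = window_sum F (m + 1) L.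
Proof. by apply: eq_bigr => i _; congr F; lia. Qed.

Lemma jacobi_bound v z psi : complex.Im z != 0 ->
  l2 R psi -> l2 R (jacobi v z psi) ->
  complex.Im z ^+ 2 * fine (l2_sqnorm psi) <= fine (l2_sqnorm (jacobi v z psi)).
Proof.
move=> y0 lpsi lchi; set y := complex.Im z in y0 *.
have y2 : 0 < y ^+ 2 by rewrite lt0r sqrf_eq0 y0 sqr_ge0.
have ny : 0 < `|y| by rewrite normr_gt0.
rewrite mulrC -ler_pdivlMr//; apply: (proj2 (l2_window _)) => N.
rewrite ler_pdivlMr// mulrC; set m := - N%:Z; set L := (2 * N).+1.
(* On each side a pair of neighbours of total mass at most [d] is sought. Each Wronskian is then at
   most d / 2, and the boundary term at most 2 |y| d = e. *)
apply/ler_addgt0Pr => e e0; pose d := e / (2 * `|y|).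
have d0 : 0 < d by rewrite divr_gt0// mulr_gt0.
pose B := fine (l2_sqnorm psi).
have [n2 Ln2 w2] : exists2 n, (L <= n)%N &
    sqc (psi (m + n%:Z)) + sqc (psi (m + n%:Z + 1)) <= d.
  apply: (small_tail (F := fun n => sqc (psi (m + n%:Z)) + sqc (psi (m + n%:Z + 1)))
    (B := B + B)) => //.
    by move=> n; rewrite addr_ge0 ?sqc_ge0.
  move=> K; rewrite big_split/= lerD//; first exact: (window_le_l2 m K lpsi).
  apply: le_trans (window_le_l2 (m + 1) K lpsi).
  by apply: ler_sum => i _ /=; rewrite addrAC.
have [n1 _ w1] : exists2 n, (0 <= n)%N &
    sqc (psi (m - 1 - n%:Z)) + sqc (psi (m - 1 - n%:Z + 1)) <= d.
  apply: (small_tail (F := fun n => sqc (psi (m - 1 - n%:Z)) + sqc (psi (m - 1 - n%:Z + 1)))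
    (B := B + B)) => //.
    by move=> n; rewrite addr_ge0 ?sqc_ge0.
  move=> K; rewrite big_split/= lerD//.
    apply: le_trans (window_le_l2 (m - K%:Z) K lpsi).
    rewrite /window_sum (reindex_inj rev_ord_inj)/=.
    by apply: ler_sum => i _ /=; rewrite (_ : _ - _ = m - K%:Z + i%:Z)//; have := ltn_ord i; lia.
  apply: le_trans (window_le_l2 (m - K%:Z + 1) K lpsi).
  rewrite /window_sum (reindex_inj rev_ord_inj)/=.
  by apply: ler_sum => i _ /=; rewrite (_ : _ - _ + _ = m - K%:Z + 1 + i%:Z)//; have := ltn_ord i; lia.
(* The boundary pairs of the enlarged window are the two small pairs; it contains the original
   window because [L <= n2]. *)
pose M := m - 1 - n1%:Z; pose L' := (n1 + 1 + n2)%N.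
have := @energy_bound R (fun i => v (M + 1 + i%:Z)) z L' (fun i => psi (M + i%:Z)) _
  (fun i _ => jacobi_window v z psi M i).
rewrite (window_sumS (fun n => sqc (psi n))) -/y -/(window_sum (@sqc R \o jacobi v z psi) _ _).
have sub := @window_sum_sub (@sqc R \o psi) m L (M + 1) L' (fun=> sqc_ge0 _).
have {}sub : window_sum (@sqc R \o psi) m L <= window_sum (@sqc R \o psi) (M + 1) L'.
  by apply: sub; rewrite /M /L'; lia.
move=> energy; apply: le_trans (ler_wpM2l (ltW y2) sub) _.
apply: le_trans energy _; rewrite addrC lerD//; first exact: window_le_l2.
have := wronskian_le (psi (M + 0%:Z)) (psi (M + 1%:Z)).
have := wronskian_le (psi (M + L'%:Z)) (psi (M + L'.+1%:Z)).
have -> : M + 0%:Z = m - 1 - n1%:Z by rewrite /M; lia.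
have -> : M + 1%:Z = m - 1 - n1%:Z + 1 by rewrite /M; lia.
have -> : M + L'%:Z = m + n2%:Z by rewrite /M /L'; lia.
have -> : M + L'.+1%:Z = m + n2%:Z + 1 by rewrite /M /L'; lia.
move=> w2' w1'; have -> : e = 2 * `|y| * d.
  by rewrite /d mulrC divfK// gt_eqF// mulr_gt0.
rewrite ler_pM2l ?mulr_gt0//; lra.
Qed.

End JacobiBound.

(** * Surjectivity by ultrafilter limits, and the resolvent set off the real axis *)

Section NonRealResolvent.
Variable R : realType.
Implicit Types (psi chi : int -> R[i]).

Lemma fmap_ultra (T U : Type) (g : T -> U) (G : set_system T) :
  UltraFilter G -> UltraFilter (g @ G).
Proof.
move=> UG; split=> [|H PH GH]; first exact: fmap_proper_filter.
apply/seteqP; split => // A HA.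
have [//|GnA] := in_ultra_setVsetC (g @^-1` A) UG.
have : H (A `&` ~` A) by apply: filterI => //; exact: GH.
by rewrite setICr => /filter_not_empty.
Qed.

(** Compactness of [-B, B]. One ultrafilter makes all sites converge at once, replacing a diagonal
    subsequence. *)
Lemma cvg_ultra_bounded (G : set_system nat) (UG : UltraFilter G)
    (u : nat -> R) (B : R) :
  (\forall n \near G, `|u n| <= B) -> cvg (u @ G).
Proof.
move=> uB; have := @segment_compact R (- B) B; rewrite compact_ultra.
have uI : G (u @^-1` `[- B, B]).
  by apply: filterS uB => n /=; rewrite in_itv/= -ler_norml.
move=> cpt; have [l [_ ul]] := cpt (u @ G) (fmap_ultra u UG) uI.
by apply/cvg_ex; exists l.
Qed.

Lemma Re_jacobi v z psi n : complex.Re (jacobi v z psi n) =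
  complex.Re (psi (n + 1)) + complex.Re (psi (n - 1)) + v n * complex.Re (psi n)
  - (complex.Re z * complex.Re (psi n) - complex.Im z * complex.Im (psi n)).
Proof.
rewrite /jacobi; case: (psi (n + 1)) (psi (n - 1)) (psi n) z => [? ?] [? ?] [? ?] [? ?] /=.
by ring.
Qed.

Lemma Im_jacobi v z psi n : complex.Im (jacobi v z psi n) =
  complex.Im (psi (n + 1)) + complex.Im (psi (n - 1)) + v n * complex.Im (psi n)
  - (complex.Re z * complex.Im (psi n) + complex.Im z * complex.Re (psi n)).
Proof.
rewrite /jacobi; case: (psi (n + 1)) (psi (n - 1)) (psi n) z => [? ?] [? ?] [? ?] [? ?] /=.
by ring.
Qed.

Lemma jacobi_surj (v : int -> R) z chi : complex.Im z != 0 -> l2 R chi ->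
  exists2 psi, l2 R psi & jacobi v z psi = chi.
Proof.
move=> y0 lchi; set y := complex.Im z in y0 *.
have y2 : 0 < y ^+ 2 by rewrite lt0r sqrf_eq0 y0 sqr_ge0.
pose X := fine (l2_sqnorm chi).
(* Index 0 of [U N] is the Dirichlet site -N - 1, and index 2N + 2 is the Dirichlet site N + 1. *)
pose base (N : nat) : int := - N%:Z - 1.
have sol N : exists u : nat -> R[i], [/\ u 0%N = 0, u (2 * N).+2 = 0 & forall i,
    u i.+2 + u i + real_complex R (v (base N + 1 + i%:Z)) * u i.+1 - z * u i.+1
      = chi (base N + 1 + i%:Z)].
  exact: (dirichlet_solution (fun i => v (base N + 1 + i%:Z)) (2 * N).+1
    (fun i => chi (base N + 1 + i%:Z)) y0).
have /choice [U HU] := sol.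
(* Left of [base N] the absolute value yields junk, harmless because each fixed site is eventually
   inside the window. *)
pose P N (n : int) : R[i] := U N (absz (n - base N)%R).
have PU N i : P N (base N + i%:Z) = U N i.
  by rewrite /P addrAC subrr add0r.
have Peq (N : nat) (n : int) : `|n| <= N%:Z -> jacobi v z (P N) n = chi n.
  move=> nN; pose i := absz (n - base N - 1)%R.
  have -> : n = base N + 1 + i%:Z by rewrite /i /base; lia.
  rewrite -jacobi_window !PU; by have [_ _] := HU N.
have Pbd N : window_sum (@sqc R \o P N) (- N%:Z) (2 * N).+1 <= X / y ^+ 2.
  rewrite ler_pdivlMr// mulrC.
  have [U0 U1 eqU] := HU N.
  have := energy_bound (L := (2 * N).+1) (fun i _ => eqU i).
  rewrite U0 U1 /wronskian !mul0r !mulr0 !subrr normr0 addr0 mulr0 add0r -/y.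
  move=> E; apply: le_trans (le_trans E _).
    rewrite le_eqVlt; apply/orP; left; apply/eqP; congr (_ * _).
    rewrite /window_sum; apply: eq_bigr => i _ /=.
    by congr (sqc _); rewrite -PU; congr P; rewrite /base; lia.
  exact: (window_le_l2 (base N + 1) (2 * N).+1 lchi).
have Pw (N : nat) (m : int) (L : nat) : (`|m| + L%:Z <= N%:Z) ->
    window_sum (@sqc R \o P N) m L <= X / y ^+ 2.
  move=> mL; apply: le_trans (Pbd N); apply: window_sum_sub.
  - by move=> n; exact: sqc_ge0.
  - by lia.
  - by lia.
have [G [UG Goo]] := @ultraFilterLemma nat \oo _.
(* The bound comes from |a| <= 1 + a^2, which avoids a square root. *)
have Pn (n : int) : \forall N \near G, `|complex.Re (P N n)| <= 1 + X / y ^+ 2 /\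
    `|complex.Im (P N n)| <= 1 + X / y ^+ 2.
  apply: Goo; exists (absz n + 1)%N => // N /= nN.
  have h : window_sum (@sqc R \o P N) n 1%N <= X / y ^+ 2 by apply: Pw; lia.
  move: h; rewrite /window_sum big_ord1 addr0 /= /sqc => h.
  set a := complex.Re _ in h *; set b := complex.Im _ in h *.
  have := sqr_ge0 a; have := sqr_ge0 b.
  rewrite -(real_normK (num_real a)) -(real_normK (num_real b)) in h *.
  move: (normr_ge0 a) (normr_ge0 b) => a0 b0 a2 b2.
  split; nra.
have cvgRe (n : int) : cvg (complex.Re (P N n) @[N --> G]).
  by apply: (@cvg_ultra_bounded G UG _ (1 + X / y ^+ 2)); apply: filterS (Pn n) => N [].
have cvgIm (n : int) : cvg (complex.Im (P N n) @[N --> G]).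
  by apply: (@cvg_ultra_bounded G UG _ (1 + X / y ^+ 2)); apply: filterS (Pn n) => N [].
pose A n := lim (complex.Re (P N n) @[N --> G]).
pose B n := lim (complex.Im (P N n) @[N --> G]).
exists (fun n => Complex (A n) (B n)).
  (* Each window is a finite sum, so the uniform bound survives the limit. *)
  apply: (proj1 (l2_window (B := X / y ^+ 2) _)) => N.
  apply: (@cvgr_to_le nat G _ R
    (fun N' => window_sum (@sqc R \o P N') (- N%:Z) (2 * N).+1)).
    apply: cvg_big => [|i _]; first exact: add_continuous.
    by rewrite /sqc/= !expr2; apply: cvgD;
      [exact: cvgM (cvgRe _) (cvgRe _)|exact: cvgM (cvgIm _) (cvgIm _)].
  by apply: Goo; exists (3 * N + 1)%N => // N' /= NN'; apply: Pw; lia.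
apply: funext => n.
have near_n : \forall N \near G, jacobi v z (P N) n = chi n.
  by apply: Goo; exists (absz n) => // N /= nN; apply: Peq; lia.
suff [Re_eq Im_eq] : complex.Re (jacobi v z (fun n => Complex (A n) (B n)) n) = complex.Re (chi n) /\
   complex.Im (jacobi v z (fun n => Complex (A n) (B n)) n) = complex.Im (chi n).
  by apply/eqP; rewrite eq_complex Re_eq Im_eq !eqxx.
split.
  apply: (@cvg_unique _ (@Rhausdorff R) (complex.Re (jacobi v z (P N) n) @[N --> G])); last first.
    by apply: cvg_near_cst; apply: filterS near_n => N ->.
  rewrite Re_jacobi /=; under eq_cvg do rewrite Re_jacobi.
  apply: cvgB; last by apply: cvgB;
    [exact: cvgM (cvg_cst _) (cvgRe _)|exact: cvgM (cvg_cst _) (cvgIm _)].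
  by apply: cvgD; [apply: cvgD|apply: cvgM (cvg_cst _) _]; exact: cvgRe.
apply: (@cvg_unique _ (@Rhausdorff R) (complex.Im (jacobi v z (P N) n) @[N --> G])); last first.
  by apply: cvg_near_cst; apply: filterS near_n => N ->.
rewrite Im_jacobi /=; under eq_cvg do rewrite Im_jacobi.
apply: cvgB; last by apply: cvgD;
  [exact: cvgM (cvg_cst _) (cvgIm _)|exact: cvgM (cvg_cst _) (cvgRe _)].
by apply: cvgD; [apply: cvgD|apply: cvgM (cvg_cst _) _]; exact: cvgIm.
Qed.

(** [jacobi_bound] gives injectivity and an inverse bounded by 1 / |Im z|; [jacobi_surj] gives
    surjectivity, its solution being in the maximal domain because H psi = chi + z psi. *)
Lemma nonreal_resolvent (f : R -> R) (alpha x : R) z : complex.Im z != 0 ->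
  resolvent_set (schrodinger f alpha x) z.
Proof.
move=> y0; pose v n := f (x + n%:~R * alpha).
have shiftE : op_shift (schrodinger f alpha x) z = jacobi v z by [].
have lsub psi chi : l2 R psi -> l2 R chi -> l2 R (fun n => psi n - chi n).
  move=> lpsi lchi; have := l2D lpsi (l2Z (-1) lchi).
  by under eq_fun do rewrite mulN1r.
have dom psi : op_dom (schrodinger f alpha x) psi ->
    l2 R psi /\ l2 R (jacobi v z psi).
  by move=> [lpsi lH]; split => //; exact: lsub lH (l2Z z lpsi).
split; last first.
  exists `|complex.Im z|^-1 => psi /dom[lpsi lchi].
  rewrite shiftE; apply: l2_normP => //.
  have := jacobi_bound y0 lpsi lchi.
  rewrite mulrC -ler_pdivlMr; first by rewrite mulrC exprVn real_normK ?num_real.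
  by rewrite lt0r sqrf_eq0 y0 sqr_ge0.
rewrite shiftE; split.
- by move=> psi /dom[].
- move=> psi psi' /set_mem/dom[lpsi lchi] /set_mem/dom[lpsi' lchi'] eqJ.
  have ld := lsub _ _ lpsi lpsi'.
  have J0 : jacobi v z (fun n => psi n - psi' n) = (fun=> 0).
    apply: funext => n; have := congr1 (fun g => g n) eqJ; rewrite /jacobi.
    by move=> /eqP; rewrite -subr_eq0 => /eqP h; rewrite -[RHS]h; ring.
  have l0 : l2 R (jacobi v z (fun n => psi n - psi' n)).
    have -> : jacobi v z (fun n => psi n - psi' n) =
      (fun n => jacobi v z psi n - jacobi v z psi' n).
      by apply: funext => n; rewrite /jacobi; ring.
    exact: lsub.
  have := jacobi_bound y0 ld l0; rewrite J0 [l2_sqnorm (fun=> 0)]l2_sqnormE esum1/=; last first.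
    by move=> n _; rewrite /sqc/= expr0n addr0.
  have y2 : 0 < complex.Im z ^+ 2 by rewrite lt0r sqrf_eq0 y0 sqr_ge0.
  rewrite pmulr_rle0// => le0; apply: funext => n.
  apply/eqP; rewrite -subr_eq0; apply/eqP/sqc_eq0/le_anti.
  rewrite sqc_ge0 andbT; apply: le_trans _ le0.
  apply: le_trans (window_le_l2 n 1 ld).
  by rewrite /window_sum big_ord1 addr0.
- move=> chi lchi; have [psi lpsi Jpsi] := jacobi_surj v y0 lchi.
  exists psi => //; split => //=.
  have -> : schrodinger_fun f alpha x psi = (fun n => chi n + z * psi n).
    by apply: funext => n; rewrite -Jpsi /jacobi /schrodinger_fun subrK.
  exact: l2D lchi (l2Z z lpsi).
Qed.
End NonRealResolvent.

(** * Orbit density and the antiperiodic phase *)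

Section Density.
Variable R : realType.

(** Pigeonhole: the N + 1 fractional parts of i alpha, 0 <= i <= N, fall into N boxes of length 1 /
    N. *)
Lemma dirichlet_approx (alpha : R) (N : nat) : (0 < N)%N ->
  exists m k : int, m != 0 /\ `|m%:~R * alpha - k%:~R| * N%:R < 1.
Proof.
move=> N0; have NR0 : 0 < N%:R :> R by rewrite ltr0n.
pose fr (i : nat) : R := i%:R * alpha - (Num.floor (i%:R * alpha))%:~R.
have fr_itv i : 0 <= fr i < 1.
  by have := floor_itv (i%:R * alpha); rewrite /fr intrD; lra.
have Nfr i : 0 <= N%:R * fr i < N%:R.
  have /andP[f0 f1] := fr_itv i.
  by rewrite (mulr_ge0 (ltW NR0) f0)/= gtr_pMr.
have lt_box i : (absz (Num.floor (N%:R * fr i)) < N)%N.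
  have /andP[f0 f1] := Nfr i; have /andP[a b] := floor_itv (N%:R * fr i).
  have p0 : 0 <= Num.floor (N%:R * fr i) by rewrite floor_ge_int.
  rewrite -ltz_nat gez0_abs// -(ltr_int R); exact: le_lt_trans a f1.
pose box (i : 'I_N.+1) : 'I_N := Ordinal (lt_box i).
have /injectivePn[i [j ij eq_box]] : ~~ injectiveb box.
  by apply/negP => /injectiveP/leq_card; rewrite !card_ord ltnn.
exists (i%:Z - j%:Z), (Num.floor (i%:R * alpha) - Num.floor (j%:R * alpha)).
split; first by apply: contraNneq ij => e; apply/eqP/val_inj => /=; lia.
have -> : (i%:Z - j%:Z)%:~R * alpha -
   (Num.floor (i%:R * alpha) - Num.floor (j%:R * alpha))%:~R = fr i - fr j.
  by rewrite /fr !rmorphB/= !pmulrn; ring.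
have {}eq_box : Num.floor (N%:R * fr i) = Num.floor (N%:R * fr j).
  have := congr1 (Posz \o val) eq_box; rewrite /= !gez0_abs//.
    by rewrite floor_ge_int; have /andP[] := Nfr j.
  by rewrite floor_ge_int; have /andP[] := Nfr i.
have := floor_itv (N%:R * fr i); have := floor_itv (N%:R * fr j).
rewrite eq_box intrD -(gtr0_norm NR0) -normrM ltr_norml (gtr0_norm NR0).
by move=> h1 h2; apply/andP; split; lra.
Qed.

(** Some m alpha - k is nonzero and shorter than [d]; integer multiples of this step lead from [x]
    to within [d] of any [z]. *)
Lemma irrational_orbit_dense (alpha : R) : irrational alpha ->
  forall x z d, 0 < d -> exists m k : int, `|x + m%:~R * alpha + k%:~R - z| < d.
Proof.
move=> irr x z d d0; pose N := (Num.bound d^-1).+1.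
have Nd : 1 < d * N%:R.
  rewrite mulrC -ltr_pdivrMr// div1r.
  apply: lt_le_trans (archi_boundP _) _; first by rewrite invr_ge0 ltW.
  by rewrite ler_nat.
have [m [k [m0 mk]]] := @dirichlet_approx alpha N isT.
pose th := m%:~R * alpha - k%:~R.
have th0 : th != 0.
  apply/eqP => th0; apply: irr; apply/rationalP.
  have mR : m%:~R != 0 :> R by rewrite intr_eq0.
  (* The sign of [m] goes to the numerator, since the denominator must be a natural number. *)
  exists (k * sgz m), `|m|%N.
  have -> : (`|m|%N%:R : R) = (m * sgz m)%:~R.
    by rewrite pmulrn; congr (_%:~R); lia.
  rewrite !rmorphM/= -mulf_div divff ?mulr1 ?intr_eq0 ?sgz_eq0//.
  by apply: (mulfI mR); rewrite mulrCA divff// mulr1; apply/eqP; rewrite -subr_eq0 -/th th0.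
have thd : `|th| < d.
  have N0 : 0 < N%:R :> R by rewrite ltr0n.
  by rewrite -(ltr_pM2r N0); apply: lt_trans mk Nd.
pose n := Num.floor ((z - x) / th).
exists (n * m), (- (n * k)).
have -> : x + (n * m)%:~R * alpha + (- (n * k))%:~R - z = th * (n%:~R - (z - x) / th).
  rewrite rmorphN !rmorphM/= mulrBr mulrCA divff// mulr1 /th; ring.
rewrite normrM; apply: le_lt_trans thd; rewrite ler_piMr//.
have := floor_itv ((z - x) / th); rewrite -/n intrD ler_norml => h.
by apply/andP; split; lra.
Qed.

End Density.

(** * Uniform continuity on the unit segment *)

Section Antiperiodic.
Variable R : realType.
Implicit Type F : R -> R.

Lemma segment_unif_continuous F : continuous F ->
  forall e, 0 < e -> exists2 d, 0 < d &
    forall x y, 0 <= x <= 1 -> `|x - y| < d -> `|F x - F y| < e.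
Proof.
move=> cF e e0; have := @segment_compact R 0 1.
move=> /compact_near_coveringP => /(_ R (0 : R)^'+
  (fun d x => forall y, `|x - y| < d -> `|F x - F y| < e) _) cov.
have {cov} : \forall d \near (0 : R)^'+, `[0, 1] `<=`
    (fun x => forall y, `|x - y| < d -> `|F x - F y| < e).
  apply: cov => x _.
  have e2 : 0 < e / 2 by rewrite divr_gt0.
  have /cvgrPdist_lt/(_ _ e2)/nbhs_ballP[r /= r0 Fr] := cF x.
  have r2 : 0 < r / 2 by rewrite divr_gt0.
  (* Halving the radius keeps both x' and its neighbours y inside the ball of radius r about x. *)
  exists (ball x (r / 2), [set d | d < r / 2]); first split.
  - exact: nbhsx_ballx.
  - exact: nbhs_right_lt.
  move=> [x' d] [/= xx' dr] y x'y.
  have h1 : `|F x - F x'| < e / 2.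
    by apply: Fr; apply: lt_trans xx' _; rewrite ltr_pdivrMr// ltr_pMr// ltr1n.
  have h2 : `|F x - F y| < e / 2.
    apply: Fr; have -> : r = r / 2 + r / 2 by rewrite -splitr.
    rewrite /ball/= -(subrK x' x) -addrA; apply: le_lt_trans (ler_normD _ _) _.
    by rewrite ltrD//; apply: lt_trans x'y dr.
  have -> : F x' - F y = (F x - F y) - (F x - F x') by ring.
  apply: le_lt_trans (ler_normB _ _) _; rewrite [e]splitr; exact: ltrD.
move=> H; have [d [Hd d0]] := filter_ex (filterI H (nbhs_right_gt 0)).
by exists d => // x y x01; apply: Hd; rewrite /= in_itv.
Qed.

End Antiperiodic.

(** * Antiperiodic extension to the line and the compactified potential *)

Section Lift.
Variable R : realType.
Implicit Type F : R -> R.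

(** Successive unit cells carry copies of [F] on [0, 1) with alternating signs; the absolute value
    in the exponent preserves parity. *)
Definition antiperiodize F (t : R) : R :=
  (-1) ^+ `|Num.floor t|%N * F (t - (Num.floor t)%:~R).

Lemma signr_absz_succ (k : int) :
  (-1) ^+ `|(k + 1)%R|%N = - (-1) ^+ `|k|%N :> R.
Proof.
rewrite -signr_odd -[in RHS]signr_odd -signrN; congr ((-1) ^+ _).
by congr nat_of_bool; lia.
Qed.

Lemma antiperiodizeS F t : antiperiodize F (t + 1) = - antiperiodize F t.
Proof.
rewrite /antiperiodize floorDrz ?rpred1// floor1 signr_absz_succ mulNr.
by congr (- (_ * F _)); rewrite intrD; ring.
Qed.

Lemma antiperiodize_norm F t :
  `|antiperiodize F t| = `|F (t - (Num.floor t)%:~R)|.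
Proof. by rewrite normrM normrX normrN1 expr1n mul1r. Qed.

Lemma frac_itv (t : R) : 0 <= t - (Num.floor t)%:~R < 1.
Proof. by have := floor_itv t; rewrite intrD; lra. Qed.

Lemma antiperiodize_unif_continuous F : continuous F -> F 1 = - F 0 ->
  forall e, 0 < e -> exists2 d, 0 < d & forall t u, `|t - u| < d ->
    `|antiperiodize F t - antiperiodize F u| < e.
Proof.
move=> cF F10 e e0; have e2 : 0 < e / 2 by rewrite divr_gt0.
have [d d0 Fd] := segment_unif_continuous cF e2.
(* Points at distance below 1 lie in the same unit cell or in adjacent ones. *)
exists (Num.min d 1); first by rewrite lt_min d0 ltr01.
move=> t u; wlog tu : t u / t <= u.
  move=> H; have [/H //|/ltW/H {}H tu] := leP t u.
  by rewrite distrC; apply: H; rewrite distrC.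
rewrite lt_min => /andP[tud tu1].
have /andP[f0 f1] := frac_itv t; have /andP[k0 k1] := floor_itv t.
have [uk|ku] := ltP u (Num.floor t + 1)%:~R.
  have -> : antiperiodize F u = (-1) ^+ `|Num.floor t|%N * F (u - (Num.floor t)%:~R).
    by rewrite /antiperiodize (floor_def (m := Num.floor t))// uk (le_trans k0).
  rewrite /antiperiodize -mulrBr normrM normrX normrN1 expr1n mul1r.
  apply: lt_trans (Fd _ _ _ _) _; first by rewrite f0 ltW.
    by rewrite opprB addrA subrK.
  by rewrite [ltRHS]splitr ltrDl.
have fu : Num.floor u = Num.floor t + 1.
  apply: floor_def; rewrite ku/= !intrD; move: tu1 k1; rewrite ler0_norm ?subr_le0//.
  by rewrite intrD; lra.
rewrite {2}/antiperiodize fu signr_absz_succ mulNr opprK /antiperiodize -mulrDr.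
rewrite normrM normrX normrN1 expr1n mul1r.
set x := t - _; set y := u - _.
(* Across an integer the signs differ, and [F 1 = - F 0] splits the difference into one small
   increment on each side. *)
have -> : F x + F y = (F x - F 1) - (F 0 - F y) by rewrite F10; ring.
have kuR := ku; rewrite intrD in kuR.
have {}tud : u - t < d by move: tud; rewrite ler0_norm ?subr_le0// opprB.
apply: le_lt_trans (ler_normB _ _) _; rewrite [e]splitr ltrD//; apply: Fd.
- by rewrite f0 ltW.
- by rewrite ler0_norm ?subr_le0 ?ltW// /x; lra.
- by rewrite lexx ler01.
- by rewrite ler0_norm /y intrD; move: k1; rewrite intrD; lra.
Qed.

Lemma antiperiodic_even F : (forall t, F (t + 1) = - F t) ->
  forall (k : int) t, F (t + (2 * k)%:~R) = F t.
Proof.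
move=> FS; have F2 t : F (t + 2) = F t.
  by have -> : t + 2 = t + 1 + 1 by [ring]; rewrite !FS opprK.
have Fn n t : F (t + (2 * n%:Z)%:~R) = F t.
  elim: n => [|n IH]; first by rewrite mulr0 addr0.
  have -> : 2 * n.+1%:Z = 2 * n%:Z + 2 by lia.
  by rewrite intrD addrA (F2 (t + _)) IH.
case=> [n|n] t; first exact: Fn.
by rewrite -[LHS](Fn n.+1) NegzE; congr F; rewrite mulrN rmorphN/= addrNK.
Qed.

Lemma periodic_int (f : R -> R) :
  (forall t, t \isn't a Num.int -> f (t + 1) = f t) ->
  forall (k : int) t, t \isn't a Num.int -> f (t + k%:~R) = f t.
Proof.
move=> f1; have fn n t : t \isn't a Num.int -> f (t + n%:R) = f t.
  move=> tZ; elim: n => [|n IH]; first by rewrite addr0.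
  rewrite -IH -natr1 addrA f1//; apply: contra tZ => h.
  by rewrite -[t](addrK n%:R) rpredB// rpred_nat.
case=> [n|n] t tZ; first by rewrite -pmulrn fn.
rewrite NegzE rmorphN/= -pmulrn -[LHS](fn n.+1) ?subrK//.
apply: contra tZ => h; rewrite -[t](subrK n.+1%:R) rpredD// rpred_nat//.
Qed.

Definition radial (w : R) : R := w / (1 + `|w|).

(** This identity turns s = 1 / (1 + |g|) into 1 - |c|, which makes sense at the endpoints too. *)
Lemma norm_radial w : `|radial w| = 1 - (1 + `|w|)^-1.
Proof.
have h : 0 < 1 + `|w| by rewrite ltr_pwDl.
rewrite /radial normrM normfV (gtr0_norm h).
by apply: (mulIf (lt0r_neq0 h)); rewrite divfK ?gt_eqF// mulrBl mulVf ?gt_eqF//; ring.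
Qed.

Lemma norm_radial_le1 w : `|radial w| <= 1.
Proof. by rewrite norm_radial gerBl invr_ge0 addr_ge0. Qed.

Lemma radial_continuous : continuous radial.
Proof.
move=> w; rewrite /radial; apply: cvgM; first exact: cvg_id.
apply: cvgV; first by rewrite lt0r_neq0// ltr_pwDl.
by apply: cvgD; [exact: cvg_cst|exact: norm_continuous].
Qed.

(** The component c on [0, 1] with its limits as end values. The constants outside only serve
    continuity on the whole line. *)
Definition phase (g : R -> R) (t : R) : R :=
  if t <= 0 then -1 else if 1 <= t then 1 else radial (g t).

Lemma phase_continuous (g : R -> R) :
  (forall t, 0 < t < 1 -> {for t, continuous g}) ->
  g t @[t --> (0 : R)^'+] --> -oo -> g t @[t --> (1 : R)^'-] --> +oo ->
  continuous (phase g).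
Proof.
move=> cg g0 g1 t.
(* Near an endpoint |g| exceeds 1 / e, which puts [radial] within [e] of 1 in modulus. *)
have radial1 e w : 0 < e -> e^-1 < `|w| -> 1 - `|radial w| < e.
  move=> e0 ew; have h : 0 < 1 + `|w| by rewrite ltr_pwDl.
  rewrite norm_radial opprB addrC subrK -[e]invrK ltf_pV2 ?posrE ?invr_gt0//.
  by apply: lt_trans ew _; rewrite ltrDr.
have [t0|t0|->] := ltgtP t 0.
- rewrite /continuous_at {2}/phase ltW//; apply: cvg_near_cst.
  by apply: filterS (lt_nbhsl t0) => u u0; rewrite /phase ltW.
- have [t1|t1|->] := ltgtP t 1.
  + have pE : {near t, radial \o g =1 phase g}.
      apply: filterS2 (lt_nbhsr t0) (lt_nbhsl t1) => u u0 u1.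
      by rewrite /phase leNgt u0 leNgt u1.
    rewrite /continuous_at {2}/phase leNgt t0 leNgt t1/=.
    apply: cvg_trans (near_eq_cvg pE) _.
    by apply: (@cvg_comp _ _ _ g radial); [apply: cg; rewrite t0|exact: radial_continuous].
  + rewrite /continuous_at {2}/phase leNgt t0/= ltW//; apply: cvg_near_cst.
    apply: filterS (lt_nbhsr t1) => u u1.
    by rewrite /phase leNgt (lt_trans _ u1)//= ltW.
  + rewrite /continuous_at {2}/phase leNgt ltr01 lexx/=.
    apply/cvgrPdist_lt => e e0; have e0' := e0; rewrite -invr_gt0 in e0'.
    move/cvgryPgt : g1 => /(_ e^-1); apply: filterS2 (lt_nbhsr ltr01) => u u0 gu.
    rewrite /phase leNgt u0/=; case: ifPn => [_|]; first by rewrite subrr normr0.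
    rewrite -ltNge => /gu {}gu; have gu0 := lt_trans e0' gu.
    have := radial1 e (g u) e0; rewrite (gtr0_norm gu0) => /(_ gu).
    have -> : `|radial (g u)| = radial (g u).
      by rewrite gtr0_norm// divr_gt0// ltr_pwDl.
    by move=> h; rewrite ger0_norm// subr_ge0 (le_trans (ler_norm _))// norm_radial_le1.
- rewrite /continuous_at {2}/phase lexx.
  apply/cvgrPdist_lt => e e0; have e0' := e0; rewrite -invr_gt0 in e0'.
  move/cvgrNyPlt : g0 => /(_ (- e^-1)); apply: filterS2 (lt_nbhsl ltr01) => u u1 gu.
  rewrite /phase; case: ifPn => [_|]; first by rewrite subrr normr0.
  rewrite -ltNge leNgt u1/= => /gu {}gu.
  have gu0 : g u < 0 by apply: lt_trans gu _; rewrite oppr_lt0.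
  have := radial1 e (g u) e0; rewrite (ltr0_norm gu0) ltrNr => /(_ gu).
  have sq : `|radial (g u)| = - radial (g u).
    by rewrite ltr0_norm// pmulr_llt0// invr_gt0 ltr_pwDl.
  rewrite sq opprK => h; rewrite distrC opprK addrC ger0_norm//.
  by rewrite -[radial _]opprK subr_ge0 -sq norm_radial_le1.
Qed.

End Lift.

(** * The singular ring *)

Section Ring.
Variable R : realType.

Lemma continuous_det n (A : R -> 'M[R]_n) :
  (forall i j, continuous (fun y => A y i j)) -> continuous (fun y => \det (A y)).
Proof.
move=> cA; rewrite /determinant; apply: continuous_big => [|s _]; first exact: add_continuous.
move=> y; apply: cvgM; first exact: cvg_cst.
by apply: cvg_big => [|i _]; [exact: mul_continuous|exact: cA].
Qed.

(** It acts on row vectors, so the coefficients follow the row index [j]. Neighbours are counted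
    with multiplicity, which covers the ring with a single site. *)
Definition ring_mx (c s : R -> R) (a : R) (q : nat) (y : R) : 'M[R]_q :=
  \matrix_(j, i) (c (y + j%:R * a) *+ (j == i) +
    s (y + j%:R * a) *+ ((j == ordS i) + (j == ord_pred i))).

Lemma ring_mx_singular (c s : R -> R) (a : R) (q : nat) :
  continuous c -> continuous s ->
  (forall t, c (t + 1) = - c t) -> (forall t, s (t + 1) = - s t) -> odd q ->
  exists y, \det (ring_mx c s a q y) = 0.
Proof.
move=> cc cs c1 s1 qodd; pose D y := \det (ring_mx c s a q y).
have cD : continuous D.
  apply: continuous_det => j i y; rewrite /continuous_at /ring_mx mxE.
  under eq_cvg do rewrite mxE.
  have sh (h : R -> R) : continuous h -> h (u + j%:R * a) @[u --> y] --> h (y + j%:R * a).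
    move=> ch; apply: (@cvg_comp _ _ _ (fun u => u + j%:R * a) h); last exact: ch.
    by apply: cvgD; [exact: cvg_id|exact: cvg_cst].
  by apply: cvgD; apply: cvgMn; exact: sh.
have D1 : D 1 = - D 0.
  rewrite /D; have -> : ring_mx c s a q 1 = -1 *: ring_mx c s a q 0.
    apply/matrixP => j i; rewrite !mxE add0r [1 + _]addrC c1 s1.
    by rewrite !mulNrn; ring.
  by rewrite detZ -signr_odd qodd mulN1r.
have [||y _ Dy] := @IVT R D 0 1 0 ler01; last by exists y.
  exact: continuous_subspaceT.
rewrite D1 ge_min le_max !oppr_le0 !oppr_ge0.
by have /orP[->|->] := le_total (D 0) 0; rewrite ?orbT.
Qed.

(** After [q] steps of slope p / q the phase has advanced by [p], a period of [c] and [s]. Hence a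
    kernel row of the singular ring matrix, repeated periodically, solves the equation at every
    index. *)
Lemma ring_kernel (c s : R -> R) (p : int) (q : nat) :
  continuous c -> continuous s ->
  (forall t, c (t + 1) = - c t) -> (forall t, s (t + 1) = - s t) ->
  (forall t, c (t + p%:~R) = c t) -> (forall t, s (t + p%:~R) = s t) -> odd q ->
  let a := p%:~R / q%:R in
  exists y (phi : nat -> R), [/\ forall n, phi (n + q)%N = phi n,
    exists2 j, (j < q)%N & phi j != 0 &
    forall n, s (y + n.+2%:R * a) * phi n.+2 + s (y + n%:R * a) * phi n
      + c (y + n.+1%:R * a) * phi n.+1 = 0].
Proof.
move=> cc cs c1 s1 cp sp qodd a.
have [y /eqP/det0P[v v0 vA]] := ring_mx_singular a cc cs c1 s1 qodd.
have q0 : (0 < q)%N by case: q qodd {a y v v0 vA}.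
pose o n := Ordinal (ltn_pmod n q0).
pose phi (n : nat) : R := v 0 (o n).
have oS n : ordS (o n) = o n.+1 by apply: val_inj; rewrite /= -addn1 modnDml addn1.
have oP n : ord_pred (o n.+1) = o n by rewrite -oS ordSK.
have per (h : R -> R) : (forall t, h (t + p%:~R) = h t) -> forall n,
    h (y + n%:R * a) = h (y + (o n)%:R * a).
  move=> hp n; rewrite [in LHS](divn_eq n q) natrD natrM /=.
  elim: (n %/ q)%N => [|d IH]; first by rewrite !mul0r add0r.
  rewrite -IH -[RHS]hp; congr h; rewrite /a -natr1.
  have qR : q%:R != 0 :> R by rewrite pnatr_eq0 -lt0n.
  by field.
exists y, phi; split.
- by move=> n; rewrite /phi; congr (v 0 _); apply: val_inj; rewrite /= modnDr.
- have /existsP[j vj] : [exists j, v 0 j != 0].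
    apply: contraNT v0 => /existsPn H; apply/eqP/rowP => j; rewrite mxE.
    by apply/eqP; have := H j; rewrite negbK.
  exists j => //; rewrite /phi; have -> : o j = j by apply: val_inj; rewrite /= modn_small.
  by [].
move=> n; rewrite (per s sp) (per s sp n) (per c cp).
have := congr1 (fun w : 'rV[R]_q => w 0 (o n.+1)) vA; rewrite !mxE.
under eq_bigr do rewrite mxE mulrDr mulrnDr mulrDr oS oP.
rewrite !big_split/=.
have single (h : 'I_q -> R) i : \sum_j v 0 j * (h j *+ (j == i)) = v 0 i * h i.
  rewrite (bigD1 i)//= eqxx mulr1n big1 ?addr0// => j /negPf ->.
  by rewrite mulr0n mulr0.
by rewrite !single /phi => E; rewrite -[RHS]E; ring.
Qed.

End Ring.

(** * Real energies *)

Section Gap.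
Variable R : realType.
Implicit Types (cf sf u F : nat -> R).

(* At [i = 0] truncated subtraction gives a spurious term [sf 0 * u 0]; all
   windows satisfy [u 0 = 0]. *)
Definition window_op cf sf u (i : nat) : R :=
  sf i.+1 * u i.+1 + sf i.-1 * u i.-1 + cf i * u i.

Lemma sum_succ F n : F 0%N = 0 -> F n = 0 ->
  \sum_(i < n) F i.+1 = \sum_(i < n) F i.
Proof.
move=> F0 Fn; have : \sum_(i < n.+1) F i = \sum_(i < n) F i + F n by rewrite big_ord_recr.
by rewrite big_ord_recl/= F0 Fn addr0 add0r.
Qed.

Lemma sum_pred_le F n : (forall i, 0 <= F i) -> F 0%N = 0 ->
  \sum_(i < n) F i.-1 <= \sum_(i < n) F i.
Proof.
move=> F_ge0 F0; case: n => [|n]; first by rewrite !big_ord0.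
by rewrite big_ord_recl/= F0 add0r [leRHS]big_ord_recr/= lerDl.
Qed.

(** A factor 3 comes from (a + b + c)^2 <= 3 (a^2 + b^2 + c^2), another from three shifted sums,
    each at most that of u^2. *)
Lemma window_op_small cf sf u w n : 0 <= w ->
  (forall i, (i <= n)%N -> `|cf i| <= w) -> (forall i, (i <= n)%N -> `|sf i| <= w) ->
  u 0%N = 0 -> u n = 0 ->
  \sum_(i < n) window_op cf sf u i ^+ 2 <= 9 * w ^+ 2 * \sum_(i < n) u i ^+ 2.
Proof.
move=> w0 cw sw u0 un.
have sq (h v : R) : `|h| <= w -> (h * v) ^+ 2 <= w ^+ 2 * v ^+ 2.
  move=> hw; rewrite exprMn ler_wpM2r ?sqr_ge0//.
  by rewrite -real_normK ?num_real// lerXn2r ?nnegrE.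
have F0 : (fun i => u i ^+ 2) 0%N = 0 by rewrite /= u0 expr0n.
have Fn : (fun i => u i ^+ 2) n = 0 by rewrite /= un expr0n.
apply: (@le_trans _ _ (3 * w ^+ 2 * (\sum_(i < n) u i.+1 ^+ 2 +
    \sum_(i < n) u i.-1 ^+ 2 + \sum_(i < n) u i ^+ 2))).
  rewrite -!big_split mulr_sumr; apply: ler_sum => i _ /=; rewrite /window_op.
  have := sq _ (u i.+1) (sw i.+1 (ltn_ord i)).
  have := sq _ (u i.-1) (sw i.-1 (leq_trans (leq_pred i) (ltnW (ltn_ord i)))).
  have := sq _ (u i) (cw i (ltnW (ltn_ord i))).
  move: (sf i.+1 * _) (sf i.-1 * _) (cf i * _) => a b c hc hb ha.
  have := sqr_ge0 (a - b); have := sqr_ge0 (a - c); have := sqr_ge0 (b - c).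
  lra.
have -> : 9 * w ^+ 2 * \sum_(i < n) u i ^+ 2 = 3 * w ^+ 2 * (\sum_(i < n) u i ^+ 2 +
    \sum_(i < n) u i ^+ 2 + \sum_(i < n) u i ^+ 2) by ring.
have /= -> := @sum_succ (fun i => u i ^+ 2) n F0 Fn.
rewrite ler_wpM2l ?mulr_ge0 ?sqr_ge0// !lerD2r lerD2l.
by apply: (@sum_pred_le (fun i => u i ^+ 2)) => // i; exact: sqr_ge0.
Qed.

Definition cutoff L (phi : nat -> R) (i : nat) : R :=
  if (0 < i <= L.+2)%N then phi i else 0.

Lemma cutoff_ge L phi i : (L.+3 <= i)%N -> cutoff L phi i = 0.
Proof. by move=> iL; rewrite /cutoff ifF// [(i <= _)%N]leqNgt iL andbF. Qed.

(** The cut solution fails the equation only at 0, 1, L + 2 and L + 3, where what remains is, up to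
    sign, a single term s phi at 1, 0, L + 3 and L + 2 respectively. *)
Lemma window_op_cutoff cf sf (phi : nat -> R) L :
  (forall i, `|sf i| <= 1) ->
  (forall i, sf i.+2 * phi i.+2 + sf i * phi i + cf i.+1 * phi i.+1 = 0) ->
  \sum_(i < L.+4) window_op cf sf (cutoff L phi) i ^+ 2 <=
    phi 0%N ^+ 2 + phi 1%N ^+ 2 + phi L.+2 ^+ 2 + phi L.+3 ^+ 2.
Proof.
move=> s1 eq_phi.
have sq (h v : R) : `|h| <= 1 -> (h * v) ^+ 2 <= v ^+ 2.
  move=> h1; rewrite exprMn ler_piMl ?sqr_ge0//.
  by rewrite -(ger0_norm (sqr_ge0 h)) normrX exprn_ile1.
rewrite big_ord_recl big_ord_recl !big_ord_recr/= big1 => [|i _]; last first.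
  rewrite /window_op /cutoff /bump /= !add1n/=.
  have iL := ltn_ord i; rewrite !ifT; try lia.
  by rewrite eq_phi expr0n.
rewrite /window_op /cutoff /bump /= !add1n /= !add0n ?ltnSn ?ltnn ?leqnn ?leqnSn.
have -> : (L.+3 < L.+2)%N = false by lia.
rewrite !mulr0 !addr0 !add0r.
have e1 : sf 2%N * phi 2%N + cf 1%N * phi 1%N = - (sf 0%N * phi 0%N).
  by apply/eqP; rewrite -addr_eq0 -[eqbRHS](eq_phi 0%N); apply/eqP; ring.
have e2 : sf L.+1 * phi L.+1 + cf L.+2 * phi L.+2 = - (sf L.+3 * phi L.+3).
  by apply/eqP; rewrite -addr_eq0 -[eqbRHS](eq_phi L.+1); apply/eqP; ring.
rewrite ?e1 ?e2 ?sqrrN.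
have := sq _ (phi 0%N) (s1 0%N); have := sq _ (phi 1%N) (s1 1%N).
have := sq _ (phi L.+2) (s1 L.+2); have := sq _ (phi L.+3) (s1 L.+3).
lra.
Qed.

(** [window_op] is linear in its coefficients: split off the exact ones and use (a + b)^2 <= 2 a^2 +
    2 b^2. *)
Lemma window_op_perturbed cf sf ch sh (phi : nat -> R) L w : 0 <= w ->
  (forall i, (i <= L.+4)%N -> `|cf i - ch i| <= w) ->
  (forall i, (i <= L.+4)%N -> `|sf i - sh i| <= w) ->
  (forall i, `|sh i| <= 1) ->
  (forall i, sh i.+2 * phi i.+2 + sh i * phi i + ch i.+1 * phi i.+1 = 0) ->
  \sum_(i < L.+4) window_op cf sf (cutoff L phi) i ^+ 2 <=
    18 * w ^+ 2 * \sum_(i < L.+4) cutoff L phi i ^+ 2 +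
    2 * (phi 0%N ^+ 2 + phi 1%N ^+ 2 + phi L.+2 ^+ 2 + phi L.+3 ^+ 2).
Proof.
move=> w0 cw sw s1 eq_phi.
have h1 := @window_op_small (fun i => cf i - ch i) (fun i => sf i - sh i)
  (cutoff L phi) w L.+4 w0 cw sw.
have {}h1 : \sum_(i < L.+4) window_op (fun i => cf i - ch i) (fun i => sf i - sh i)
    (cutoff L phi) i ^+ 2 <= 9 * w ^+ 2 * \sum_(i < L.+4) cutoff L phi i ^+ 2.
  by apply: h1; rewrite /cutoff// ifF//; lia.
have h2 := window_op_cutoff L s1 eq_phi.
apply: (@le_trans _ _ (2 * (\sum_(i < L.+4) window_op (fun i => cf i - ch i) (fun i => sf i - sh i)
    (cutoff L phi) i ^+ 2) + 2 * (\sum_(i < L.+4) window_op ch sh (cutoff L phi) i ^+ 2))).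
  rewrite !mulr_sumr -big_split; apply: ler_sum => i _ /=.
  have -> : window_op cf sf (cutoff L phi) i = window_op (fun i => cf i - ch i)
      (fun i => sf i - sh i) (cutoff L phi) i + window_op ch sh (cutoff L phi) i.
    by rewrite /window_op; ring.
  move: (window_op _ _ _ _) (window_op _ _ _ _) => a b.
  have := sqr_ge0 (a - b); lra.
move: h1 h2; set A := \sum_(i < _) _; set B := \sum_(i < _) _; set D := \sum_(i < _) _; lra.
Qed.

Lemma sum_periodic F q : (forall n, F (n + q)%N = F n) ->
  forall i, \sum_(j < q) F (j + i)%N = \sum_(j < q) F j.
Proof.
move=> Fq; elim=> [|i IH]; first by apply: eq_bigr => j _; rewrite addn0.
rewrite -IH; case: q Fq IH => [|q] Fq _; first by rewrite !big_ord0.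
rewrite big_ord_recr [RHS]big_ord_recl/=.
rewrite -addSnnS [(_ + i)%N]addnC Fq add0n addrC; congr (_ + _).
by apply: eq_bigr => j _; rewrite /bump /= add1n addSnnS.
Qed.

(** Substitution gives S <= S / 2 + 2 C B, and half of S is absorbed on the left. *)
Lemma absorb (C w2 S T B : R) : 0 < C -> 18 * w2 * C <= 1 / 2 -> 0 <= S ->
  S <= C * T -> T <= 18 * w2 * S + 2 * B -> S <= 4 * C * B.
Proof.
move=> C0 wC S0 ST TS; have h1 := ler_wpM2r S0 wC; have h2 := ler_wpM2l (ltW C0) TS.
lra.
Qed.

Lemma no_uniform_gap (c s : R -> R) (alpha x C : R) :
  irrational alpha -> 0 < C ->
  (forall e, 0 < e -> exists2 d, 0 < d & forall t t', `|t - t'| < d -> `|c t - c t'| < e) ->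
  (forall e, 0 < e -> exists2 d, 0 < d & forall t t', `|t - t'| < d -> `|s t - s t'| < e) ->
  (forall t, c (t + 1) = - c t) -> (forall t, s (t + 1) = - s t) ->
  (forall (k : int) t, c (t + (2 * k)%:~R) = c t) ->
  (forall (k : int) t, s (t + (2 * k)%:~R) = s t) ->
  (forall t, `|s t| <= 1) ->
  ~ (forall (m k : int) n u, u 0%N = 0 -> (forall i, (n <= i)%N -> u i = 0) ->
      let t (i : nat) := x + (m + i%:Z)%:~R * alpha + k%:~R in
      \sum_(i < n.+1) u i ^+ 2 <= C * \sum_(i < n.+1) window_op (c \o t) (s \o t) u i ^+ 2).
Proof.
move=> irr C0 uc us c1 s1 c2 s2 s_le1 gap.
have unif_cont (h : R -> R) : (forall e, 0 < e -> exists2 d, 0 < d &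
    forall t t', `|t - t'| < d -> `|h t - h t'| < e) -> continuous h.
  move=> uh t; apply/cvgrPdist_lt => e /uh[d d0 hd].
  by apply/nbhs_ballP; exists d => // u; exact: hd.
(* Chosen so that 18 w^2 C = C / (2 (1 + C)^2), as [absorb] requires. *)
pose w : R := (6 * (1 + C))^-1.
have w0 : 0 < w by rewrite invr_gt0; lra.
have wC : 18 * w ^+ 2 * C <= 1 / 2.
  rewrite /w exprVn exprMn; have C1 : 0 < (1 + C) ^+ 2 by rewrite exprn_gt0//; lra.
  rewrite invfM mulrA mulrAC ler_pdivrMr//; have := sqr_ge0 C; nra.
have [L CL] : exists L : nat, 16 * C < L%:R.
  by exists (Num.bound (16 * C)); apply: archi_boundP; lra.
have [dc dc0 Hc] := uc _ w0; have [ds ds0 Hs] := us _ w0.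
have [d d0 [ddc dds]] : exists2 d : R, 0 < d & d <= dc /\ d <= ds.
  by exists (Num.min dc ds); rewrite ?lt_min ?dc0// !ge_min !lexx orbT.
(* With |alpha - a| <= 2 / q, this size of [q] keeps the drift over L + 4 sites below d / 2. *)
have [q qodd qd] : exists2 q, odd q & 2 * L.+4%:R * 2 / d < q%:R.
  pose K := Num.bound (2 * L.+4%:R * 2 / d).
  exists K.*2.+1; first by rewrite oddS odd_double.
  have K2 : (K <= K.*2.+1)%N by rewrite -addnn -addSn leq_addl.
  have : 2 * L.+4%:R * 2 / d < K%:R by apply: archi_boundP; rewrite divr_ge0 ?mulr_ge0// ltW.
  by move=> /lt_le_trans; apply; rewrite ler_nat.
have q0 : 0 < q%:R :> R by rewrite ltr0n odd_gt0.
(* Only even integers are periods of [c] and [s], hence an error up to 2 in q alpha. *)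
pose p : int := 2 * Num.floor (q%:R * alpha / 2).
pose a : R := p%:~R / q%:R.
have pa : `|alpha - a| <= 2 / q%:R.
  have -> : alpha - a = (q%:R * alpha - p%:~R) / q%:R by rewrite /a; field; rewrite gt_eqF.
  rewrite normrM normfV (gtr0_norm q0) ler_pM2r ?invr_gt0//.
  have := floor_itv (q%:R * alpha / 2); rewrite /p intrM intrD ler_norml => h.
  by apply/andP; split; lra.
have [y [phi [phiq [j0 j0q phi0] eq_phi]]] := @ring_kernel R c s p q
  (unif_cont _ uc) (unif_cont _ us) c1 s1 (c2 _) (s2 _) qodd.
rewrite -/a in eq_phi.
pose F n := phi n ^+ 2; pose P := \sum_(j < q) F j.
have Fq n : F (n + q)%N = F n by rewrite /F phiq.
have P0 : 0 < P.
  rewrite /P (bigD1 (Ordinal j0q))//= ltr_pwDl ?sumr_ge0//.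
    by rewrite /F lt0r sqrf_eq0 phi0 sqr_ge0.
  by move=> i _; exact: sqr_ge0.
have key j : \sum_(i < L.+2) F (j + i.+1)%N <=
    4 * C * (F (j + 0)%N + F (j + 1)%N + F (j + L.+2)%N + F (j + L.+3)%N).
  have dd : 0 < d / 2 by rewrite divr_gt0.
  (* A piece of the orbit of [x] is made to shadow the ring from site [j] on; the other d / 2 is
     left for the drift. *)
  have [m [k mk]] := irrational_orbit_dense irr x (y + j%:R * a) dd.
  pose t (i : nat) := x + (m + i%:Z)%:~R * alpha + k%:~R.
  pose th (i : nat) := y + (j + i)%:R * a.
  pose phij i := phi (j + i)%N.
  have close i : (i <= L.+4)%N -> `|t i - th i| < d.
    move=> iL; have -> : t i - th i =
        (x + m%:~R * alpha + k%:~R - (y + j%:R * a)) + i%:R * (alpha - a).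
      by rewrite /t /th intrD natrD -pmulrn; ring.
    apply: le_lt_trans (ler_normD _ _) _; rewrite [d]splitr ltr_leD//.
    have iL' : i%:R <= L.+4%:R :> R by rewrite ler_nat.
    rewrite normrM normr_nat; apply: le_trans (ler_pM _ _ iL' pa) _ => //.
    rewrite mulrA ler_pdivrMr// mulrC; move: qd; rewrite ltr_pdivrMr// => qd.
    lra.
  have u0 : cutoff L phij 0 = 0 by [].
  have uL := @cutoff_ge L phij.
  have := gap m k L.+3 _ u0 uL; rewrite -/t => gapj.
  have defect := @window_op_perturbed (c \o t) (s \o t) (c \o th) (s \o th) phij L w (ltW w0).
  have {}defect := defect
    (fun i iL => ltW (Hc _ _ (lt_le_trans (close i iL) ddc)))
    (fun i iL => ltW (Hs _ _ (lt_le_trans (close i iL) dds)))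
    (fun i => s_le1 _).
  have eqj i : (s \o th) i.+2 * phij i.+2 + (s \o th) i * phij i
      + (c \o th) i.+1 * phij i.+1 = 0.
    by rewrite /= /th /phij !addnS; exact: eq_phi.
  have {}defect := defect eqj.
  have cutE : \sum_(i < L.+4) cutoff L phij i ^+ 2 = \sum_(i < L.+2) F (j + i.+1)%N.
    rewrite big_ord_recl big_ord_recr/= u0 (uL (bump 0 L.+2))// expr0n add0r addr0.
    by apply: eq_bigr => i _; rewrite /cutoff /bump/= add1n ltn_ord.
  rewrite cutE in gapj defect.
  have S0 : 0 <= \sum_(i < L.+2) F (j + i.+1)%N by apply: sumr_ge0 => i _; exact: sqr_ge0.
  exact: absorb C0 wC S0 gapj defect.
(* Every shift of [F] has ring sum [P], so summing [key] over [j] gives (L + 2) P <= 16 C P, against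
   16 C < L. *)
have sumP : \sum_(j < q) \sum_(i < L.+2) F (j + i.+1)%N = L.+2%:R * P.
  rewrite exchange_big/= mulr_natl -[L.+2 in RHS]card_ord -sumr_const.
  by apply: eq_bigr => i _; exact: sum_periodic.
have : L.+2%:R * P <= 4 * C * (P + P + P + P).
  rewrite -sumP; apply: (@le_trans _ _ (\sum_(j < q) (4 * C *
      (F (j + 0)%N + F (j + 1)%N + F (j + L.+2)%N + F (j + L.+3)%N)))).
    by apply: ler_sum => j _; exact: key.
  by rewrite -mulr_sumr !big_split/= !(sum_periodic Fq).
have -> : L.+2%:R = L%:R + 2 :> R by rewrite -addn2 natrD.
nra.
Qed.

End Gap.

(** * From a bounded resolvent to a uniform gap on windows *)

Section ResolventGap.
Variable R : realType.

Lemma window_sum_support (F : int -> R) (m : int) n (m' : int) L' :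
  (forall k, 0 <= F k) -> (forall k, F k != 0 -> m <= k < m + n%:Z) ->
  window_sum F m' L' <= window_sum F m n.
Proof.
move=> F0 Fs; rewrite !window_sumE (bigID (fun k => F k == 0))/=.
rewrite big1 => [|k /eqP//]; rewrite add0r -big_filter.
apply: ler_sum_subseq => //; [exact: filter_uniq (window_uniq _ _)|exact: window_uniq|].
move=> k; rewrite mem_filter => /andP[/Fs mk _].
apply/mapP; exists (absz (k - m)%R); last by lia.
by rewrite mem_iota; lia.
Qed.

Lemma l2_finite_support (psi : int -> R[i]) (m : int) n :
  (forall k, psi k != 0 -> m <= k < m + n%:Z) ->
  l2 R psi /\ fine (l2_sqnorm psi) = window_sum (@sqc R \o psi) m n.
Proof.
move=> psi0; have F0 k : 0 <= (@sqc R \o psi) k by exact: sqc_ge0.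
have Fs k : (@sqc R \o psi) k != 0 -> m <= k < m + n%:Z.
  move=> h; apply: psi0; apply: contraNneq h => /= ->.
  by rewrite /sqc/= expr0n addr0.
have [lpsi le] := l2_window (fun N => @window_sum_support _ m n _ (2 * N).+1 F0 Fs).
by split => //; apply/le_anti; rewrite le window_le_l2.
Qed.

(** The resolvent controls only s u. Since c^2 + s^2 >= 1/2, it remains to control c u, which is
    [window_op] minus two neighbouring values of s u; the sums add up to 14 copies of (s u)^2 and 6
    of the squared operator. *)
Lemma potential_bound (cf sf u : nat -> R) (M2 : R) n :
  (forall i, `|cf i| + `|sf i| = 1) -> u 0%N = 0 -> u n = 0 ->
  \sum_(i < n) (sf i * u i) ^+ 2 <= M2 * \sum_(i < n) window_op cf sf u i ^+ 2 ->
  \sum_(i < n) u i ^+ 2 <= (14 * M2 + 6) * \sum_(i < n) window_op cf sf u i ^+ 2.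
Proof.
move=> cs u0 un; pose F i := (sf i * u i) ^+ 2.
have F0 : F 0%N = 0 by rewrite /F u0 mulr0 expr0n.
have Fn : F n = 0 by rewrite /F un mulr0 expr0n.
have le1 : \sum_(i < n) u i ^+ 2 <= \sum_(i < n)
    (2 * F i + 6 * (window_op cf sf u i ^+ 2 + F i.+1 + F i.-1)).
  apply: ler_sum => i _.
  have cs2 : 1 <= 2 * (cf i ^+ 2 + sf i ^+ 2).
    have := cs i; rewrite -(real_normK (num_real (cf i))) -(real_normK (num_real (sf i))).
    move: `|cf i| `|sf i| => a b ab; have := sqr_ge0 (a - b).
    have : (a + b) ^+ 2 = 1 by rewrite ab expr1n.
    lra.
  have h1 : u i ^+ 2 <= 2 * ((cf i * u i) ^+ 2 + F i).
    have := ler_wpM2r (sqr_ge0 (u i)) cs2; rewrite /F !exprMn; lra.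
  have : cf i * u i = window_op cf sf u i - sf i.+1 * u i.+1 - sf i.-1 * u i.-1.
    by rewrite /window_op; ring.
  move: h1; rewrite /F; move: (cf i * u i) (sf i.+1 * u i.+1) (sf i.-1 * u i.-1) (window_op _ _ _ _).
  move=> a b c d h1 ea; rewrite {}ea in h1.
  have := sqr_ge0 (d + b); have := sqr_ge0 (d + c); have := sqr_ge0 (b - c); lra.
move: le1; rewrite !(big_split, =^~ mulr_sumr)/= (sum_succ F0 Fn).
have := sum_pred_le n (fun i => sqr_ge0 (sf i * u i)) F0; rewrite -/F.
move: (\sum_(i < n) window_op cf sf u i ^+ 2) (\sum_(i < n) F i.-1) (\sum_(i < n) F i) (\sum_(i < n) u i ^+ 2).
move=> T S S' U; lra.
Qed.

(** Test the resolvent bound on psi = s u: because (f - E) s = c, the vector (H - E) psi is exactly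
    [window_op] of u. *)
Lemma resolvent_gap (f c s : R -> R) (alpha x E : R) :
  (forall n k : int, let t := x + n%:~R * alpha + k%:~R in
    (f (x + n%:~R * alpha) - E) * s t = c t) ->
  (forall t, `|c t| + `|s t| = 1) ->
  resolvent_set (schrodinger f alpha x) (real_complex R E) ->
  exists2 C, 0 < C & forall (m k : int) n u, u 0%N = 0 ->
    (forall i, (n <= i)%N -> u i = 0) ->
    let t (i : nat) := x + (m + i%:Z)%:~R * alpha + k%:~R in
    \sum_(i < n.+1) u i ^+ 2 <= C * \sum_(i < n.+1) window_op (c \o t) (s \o t) u i ^+ 2.
Proof.
move=> fcs cs1 [_ [M bound]]; exists (14 * M ^+ 2 + 6).
  by have := sqr_ge0 M; lra.
move=> m k n u u0 un; pose t (i : nat) := x + (m + i%:Z)%:~R * alpha + k%:~R.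
apply: (@potential_bound (c \o t) (s \o t)) => //.
- by move=> i; exact: cs1.
- by apply: un; exact: leqnSn.
pose T := window_op (c \o t) (s \o t) u.
pose psi (l : int) : R[i] :=
  if l - m is Posz i then real_complex R (s (t i) * u i) else 0.
pose chi (l : int) : R[i] := if l - m is Posz i then real_complex R (T i) else 0.
have psiE i : psi (m + i%:Z) = real_complex R (s (t i) * u i).
  by rewrite /psi addrAC subrr add0r.
have chiE i : chi (m + i%:Z) = real_complex R (T i).
  by rewrite /chi addrAC subrr add0r.
have psi_neg l : l <= m -> psi l = 0.
  rewrite le_eqVlt => /orP[/eqP->|lm].
    by rewrite -[m]addr0 (psiE 0%N) u0 mulr0.
  rewrite /psi; case e : (l - m) => [i|//]; lia.
have shiftE : op_shift (schrodinger f alpha x) (real_complex R E) psi = chi.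
  apply: funext => l; rewrite /op_shift/= /schrodinger_fun.
  have [lm|ml] := ltP l m.
    rewrite !psi_neg; try lia.
    rewrite !mulr0 !addr0 subr0 /chi; case e : (l - m) => [i|//]; lia.
  have [i ->] : exists i : nat, l = m + i%:Z by exists (absz (l - m)%R); lia.
  rewrite chiE psiE.
  have -> : m + i%:Z + 1 = m + i.+1%:Z by lia.
  rewrite psiE.
  (* At i = 0 the truncated predecessor is 0, and both sides vanish by [u0]. *)
  have -> : psi (m + i%:Z - 1) = real_complex R (s (t i.-1) * u i.-1).
    case: i => [|i]; first by rewrite addr0 psi_neg ?u0 ?mulr0//; lia.
    by have -> : m + i.+1%:Z - 1 = m + i%:Z by lia.
  rewrite -!rmorphM -!rmorphD -rmorphB; congr (real_complex R _).
  by rewrite /T /window_op /= -(fcs (m + i%:Z) k) -/(t i); ring.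
have [lpsi psi_eq] : l2 R psi /\ fine (l2_sqnorm psi) = window_sum (@sqc R \o psi) m n.+1.
  apply: l2_finite_support => l; rewrite /psi; case e : (l - m) => [i|]; last by rewrite eqxx.
  have [ni|ni _] := leqP n i; first by rewrite un// mulr0 eqxx.
  by lia.
(* The support grows by one site, because site [n] still sees u at n - 1. *)
have [lchi chi_eq] : l2 R chi /\ fine (l2_sqnorm chi) = window_sum (@sqc R \o chi) m n.+1.
  apply: l2_finite_support => l; rewrite /chi; case e : (l - m) => [i|]; last by rewrite eqxx.
  have [ni|ni _] := leqP n.+1 i; last by lia.
  by rewrite /T /window_op !un ?mulr0 ?addr0 ?eqxx//; lia.
have dom : op_dom (schrodinger f alpha x) psi.
  split => //; have -> : schrodinger_fun f alpha x psi =
      (fun l => chi l + real_complex R E * psi l).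
    by apply: funext => l; rewrite -shiftE /op_shift subrK.
  exact: l2D lchi (l2Z _ lpsi).
have := bound psi dom; rewrite shiftE => le_norm.
(* The sign of [M] is unknown, but [le_norm] itself makes the right-hand side nonnegative. *)
have {le_norm} : l2_norm psi ^+ 2 <= (M * l2_norm chi) ^+ 2.
  by rewrite lerXn2r ?nnegrE ?(le_trans _ le_norm)// sqrtr_ge0.
rewrite exprMn !l2_norm_sqr psi_eq chi_eq.
have sqR (y : R) : sqc (real_complex R y) = y ^+ 2 by rewrite /sqc/= expr0n addr0.
rewrite /window_sum; under eq_bigr do rewrite /= psiE sqR.
by under [in leRHS]eq_bigr do rewrite /= chiE sqR.
Qed.

End ResolventGap.

(** * The regularised pair along the orbit, and the spectrum *)

Lemma antiperiodic_phase (R : realType) (f : R -> R) (alpha x E : R) :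
  (forall t : R, t \isn't a Num.int -> f (t + 1) = f t) ->
  (forall m n : int, x <> m%:~R + n%:~R * alpha) ->
  let ph := phase (fun t => f t - E) in
  forall n k : int, let t := x + n%:~R * alpha + k%:~R in
    (f (x + n%:~R * alpha) - E) * antiperiodize (fun t => 1 - `|ph t|) t =
      antiperiodize ph t.
Proof.
move=> f1 xZ ph n k t.
have nZ : x + n%:~R * alpha \isn't a Num.int.
  apply/negP => /intrP[j e]; apply: (xZ j (- n)).
  by rewrite -e rmorphN; ring.
have rE : t - (Num.floor t)%:~R = x + n%:~R * alpha + (k - Num.floor t)%:~R.
  by rewrite /t rmorphB/= addrA.
have /andP[r0 r1] := frac_itv t.
(* The orbit avoids the integers, so the fractional part is inside (0, 1), where c = g / (1 + |g|)
   and s = 1 / (1 + |g|) carry the same sign. *)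
have r_neq0 : t - (Num.floor t)%:~R != 0.
  apply: contraNneq nZ => r0'; have -> : x + n%:~R * alpha = (Num.floor t - k)%:~R.
    by move: r0'; rewrite rE !rmorphB/= => ?; lra.
  exact: rpred_int.
rewrite /antiperiodize /ph /phase leNgt lt0r r_neq0 r0 leNgt r1/=.
rewrite rE (periodic_int f1)// norm_radial subKr /radial.
by ring.
Qed.

(** The result covers irrational [alpha], a restriction absent from the English sentence. It cannot
    be lifted: for alpha = 0 the potential is the constant f(x), and the spectrum is
    [f(x) - 2, f(x) + 2]. Irrationality enters through orbit density at real energies. *)
Theorem theorem1p2 (R : realType) (f : R -> R)
    (f_periodic : forall t : R, t \isn't a Num.int -> f (t + 1) = f t)
    (f_continuous : forall t : R, 0 < t < 1 -> {for t, continuous f})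
    (f_right0 : f t @[t --> (0 : R)^'+] --> -oo)
    (f_left1 : f t @[t --> (1 : R)^'-] --> +oo)
    (alpha x : R) (alpha_irrational : irrational alpha)
    (x_notin : forall m n : int, x <> m%:~R + n%:~R * alpha) :
  spectrum (schrodinger f alpha x) = range (real_complex R).
Proof.
apply/seteqP; split => [z zS|_ [E _ <-] EH].
  have [y0|y0] := eqVneq (complex.Im z) 0; last first.
    by case: zS; exact: nonreal_resolvent.
  by exists (complex.Re z) => //; case: z y0 {zS} => a b /= ->.
pose ph := phase (fun t => f t - E).
have ph_cont : continuous ph.
  apply: phase_continuous.
  - by move=> t t01; apply: cvgB; [exact: f_continuous|exact: cvg_cst].
  - apply/cvgrNyPlt => A; move/cvgrNyPlt : f_right0 => /(_ (A + E)).
    by apply: filterS => t; rewrite ltrBlDr.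
  - apply/cvgryPgt => A; move/cvgryPgt : f_left1 => /(_ (A + E)).
    by apply: filterS => t; rewrite ltrBrDr.
have ph_le1 t : `|ph t| <= 1.
  rewrite /ph /phase; case: ifP => _; first by rewrite normrN1.
  by case: ifP => _; [rewrite normr1|exact: norm_radial_le1].
(* It vanishes at 0 and at 1, so it too satisfies the gluing condition [s0 1 = - s0 0]. *)
pose s0 t := 1 - `|ph t|.
have s0_cont : continuous s0.
  move=> t; apply: cvgB; first exact: cvg_cst.
  exact: cvg_norm (ph_cont t).
have ph0 : ph 0 = -1 by rewrite /ph /phase lexx.
have ph1 : ph 1 = 1 by rewrite /ph /phase leNgt ltr01 lexx.
pose c := antiperiodize ph; pose s := antiperiodize s0.
have cs1 t : `|c t| + `|s t| = 1.
  by rewrite !antiperiodize_norm /s0 (@ger0_norm _ (1 - _)) ?subr_ge0// addrC subrK.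
have cS t : c (t + 1) = - c t by exact: antiperiodizeS.
have sS t : s (t + 1) = - s t by exact: antiperiodizeS.
have [C C0 gap] := resolvent_gap (antiperiodic_phase E f_periodic x_notin) cs1 EH.
apply: (no_uniform_gap alpha_irrational C0 _ _ cS sS _ _ _ gap).
- by apply: antiperiodize_unif_continuous; rewrite // ph0 ph1 opprK.
- by apply: antiperiodize_unif_continuous; rewrite // /s0 ph0 ph1 normrN1 normr1 subrr oppr0.
- exact: antiperiodic_even cS.
- exact: antiperiodic_even sS.
- by move=> t; rewrite -(cs1 t) lerDr.
Qed.
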